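(* For every cardinal number $\kappa$, $\Theta(\kappa)$ is a topological subgroup of $O(\kappa)$ with the topology induced by the operator norm $\|\cdot\|_{\mathrm{op}}$.
   Context: Let $\mathcal{H}$ be a real Hilbert space of Hilbert dimension $\kappa$ and $\mathscr{B}(\mathcal{H})$ the bounded linear operators on it, with operator norm $\|\cdot\|_{\mathrm{op}}$. An operator $L\in\mathscr{B}(\mathcal{H})$ is a reflection operator if there is an orthonormal set $\{e_\alpha\}_{\alpha\in\mathfrak{A}}$ in $\mathcal{H}$ (of any cardinality, possibly empty) such that $L=2P-I$, where $P x=\sum_{\alpha\in\mathfrak{A}}\langle x,e_\alpha\rangle e_\alpha$. Let $\mathrm{Refl}(\mathcal{H})$ be the set of reflection operators on $\mathcal{H}$. $\Theta(\kappa)$ is the set of all $A\in\mathscr{B}(\mathcal{H})$ that are products $A=\prod_{j=1}^{m}L_j$ of finitely many elements $L_j\in\mathrm{Refl}(\mathcal{H})$, with operator composition. $O(\kappa)=\mathrm{Aut}(\mathcal{H})$ is the group, under composition, of all bijective linear maps $\sigma:\mathcal{H}\to\mathcal{H}$ with $\langle\sigma x,\sigma y\rangle=\langle x,y\rangle$ for all $x,y\in\mathcal{H}$. Both are given the subspace topology from $(\mathscr{B}(\mathcal{H}),\|\cdot\|_{\mathrm{op}})$. *)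

(* Defs.v *)
From HB Require Import structures.
From mathcomp Require Import all_boot all_order all_algebra.
From mathcomp Require Import sesquilinear.
From mathcomp Require Import all_classical all_reals all_analysis.
From mathcomp Require Import showcase.summability.

Set Implicit Arguments.
Unset Strict Implicit.
Unset Printing Implicit Defensive.

Import Order.TTheory GRing.Theory Num.Theory.
Import numFieldNormedType.Exports.

Local Open Scope classical_set_scope.
Local Open Scope ring_scope.

(** No compatibility between the group law and the topology is built in. *)
#[short(type="preTopologicalGroupType")]
HB.structure Definition PreTopologicalGroup := {G of Group G & Topological G}.

Definition topological_group (G : preTopologicalGroupType) : Prop :=
  continuous (fun p : G * G => p.1 * p.2)%g /\
  continuous (fun x : G => x^-1)%g.

Definition topological_subgroup (G : preTopologicalGroupType) (S : set G) :
    Prop :=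
  [/\ group_closed (mem S),
      {within S `*` S, continuous (fun p : G * G => p.1 * p.2)%g}
    & {within S, continuous (fun x : G => x^-1)%g}].

HB.mixin Record CompleteNormedModule_isHilbert (R : realType) H
    & CompleteNormedModule R H := {
  inner : {dot H for (@idfun R)};
  inner_norm : forall x : H, inner x x = `|x| ^+ 2
}.

#[short(type="hilbertType")]
HB.structure Definition Hilbert (R : realType) :=
  {H of CompleteNormedModule R H & CompleteNormedModule_isHilbert R H}.

Section hilbert.
Context {R : realType} {H : hilbertType R}.

Definition orthonormal_family (I : Type) (e : I -> H) : Prop :=
  (forall i, inner (e i) (e i) = 1) /\
  (forall i j, i <> j -> inner (e i) (e j) = 0).

(** [y] is the unordered (norm-convergent, along the finite subsets of [I])
    sum of the [<x, e i> e i]. *)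
Definition fourier_sum (I : choiceType) (e : I -> H) (x y : H) : Prop :=
  partial_sum (fun i => inner x (e i) *: e i) @ totally --> y.

End hilbert.

(** The cardinal is represented by the type [K] indexing an orthonormal basis;
    classically, requiring a [choiceType] is no restriction. *)
Definition hilbert_dimension (R : realType) (H : hilbertType R)
    (K : choiceType) : Prop :=
  exists e : K -> H, orthonormal_family e /\ forall x, fourier_sum e x x.

Definition bounded_linear (R : realType) (H : hilbertType R) (f : H -> H) :
    Prop :=
  linear f /\ exists M : R, forall x, `|f x| <= M * `|x|.

Definition bounded_linearb (R : realType) (H : hilbertType R) :
  {pred H -> H} := fun f => `[< bounded_linear f >].

Record bop (R : realType) (H : hilbertType R) := Bop {
  bop_fun :> H -> H;
  bop_funP : bop_fun \in @bounded_linearb R H }.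

HB.instance Definition _ (R : realType) (H : hilbertType R) :=
  [isSub for @bop_fun R H].
HB.instance Definition _ (R : realType) (H : hilbertType R) :=
  [Choice of bop H by <:].

Section bop_theory.
Context {R : realType} {H : hilbertType R}.
Implicit Types (A B : bop H) (x y : H).

Lemma bounded_linear_submod : submod_closed (@bounded_linearb R H).
Proof.
split=> [|a f g].
  apply/asboolP; split=> [c x y|]; first by rewrite /= scaler0 addr0.
  by exists 0 => x; rewrite mul0r normr0.
move=> /asboolP[fL [M fM]] /asboolP[gL [N gN]]; apply/asboolP; split.
  move=> c x y; change (a *: f (c *: x + y) + g (c *: x + y) =
    c *: (a *: f x + g x) + (a *: f y + g y)).
  rewrite fL gL !scalerDr addrACA; congr (_ + _ + _).
  by rewrite !scalerA mulrC.
exists (`|a| * M + N) => x; change (`|a *: f x + g x| <= (`|a| * M + N) * `|x|).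
rewrite mulrDl (le_trans (ler_normD _ _))// lerD// normrZ -mulrA.
by rewrite ler_wpM2l.
Qed.

HB.instance Definition _ := GRing.isSubmodClosed.Build R (H -> H)
  (@bounded_linearb R H) bounded_linear_submod.

HB.instance Definition _ := [SubChoice_isSubLmodule of bop H by <:].

Lemma bopP A : bounded_linear A.
Proof. exact/asboolP/(bop_funP A). Qed.

Lemma bop_eqP A B : A =1 B -> A = B.
Proof. by move=> AB; apply/val_inj/funext. Qed.

Lemma bop_linear A : linear A. Proof. by case: (bopP A). Qed.

Lemma bop0 A : A 0 = 0.
Proof. by have := bop_linear A (-1) 0 0; rewrite scaleN1r addNr scaleN1r addNr. Qed.

Lemma bopD A x y : A (x + y) = A x + A y.
Proof. by have := bop_linear A 1 x y; rewrite !scale1r. Qed.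

Lemma bopZ A c x : A (c *: x) = c *: A x.
Proof. by have := bop_linear A c x 0; rewrite bop0 !addr0. Qed.

Lemma bounded_linear_id : bounded_linear (@id H).
Proof. by split=> //; exists 1 => x; rewrite mul1r. Qed.

Lemma bounded_linear_comp A B : bounded_linear (A \o B).
Proof.
split=> [c x y|]; first by rewrite /= bopD bopZ bopD bopZ.
have [[_ [M AM]] [_ [N BN]]] := (bopP A, bopP B).
exists (`|M| * N) => x; rewrite /= (le_trans (AM _))// -mulrA.
rewrite (@le_trans _ _ (`|M| * `|B x|))//; first by rewrite ler_wpM2r// ler_norm.
by rewrite ler_wpM2l.
Qed.

Definition bop_one : bop H := Bop (asboolT bounded_linear_id).
Definition bop_mul A B : bop H := Bop (asboolT (bounded_linear_comp A B)).

Lemma bop_mulA : associative bop_mul. Proof. by move=> A B C; apply: bop_eqP. Qed.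
Lemma bop_mul1l : left_id bop_one bop_mul. Proof. by move=> A; apply: bop_eqP. Qed.
Lemma bop_mul1r : right_id bop_one bop_mul. Proof. by move=> A; apply: bop_eqP. Qed.
Lemma bop_mulDl : left_distributive bop_mul +%R.
Proof. by move=> A B C; apply: bop_eqP. Qed.
Lemma bop_mulDr : right_distributive bop_mul +%R.
Proof. by move=> A B C; apply: bop_eqP => x; exact: bopD. Qed.

HB.instance Definition _ := GRing.Zmodule_isPzRing.Build (bop H)
  bop_mulA bop_mul1l bop_mul1r bop_mulDl bop_mulDr.

Definition opnorm A : R := sup [set `|A x| | x in [set x : H | `|x| <= 1]].

Lemma opnorm_has_sup A : has_sup [set `|A x| | x in [set x : H | `|x| <= 1]].
Proof.
split; first by exists `|A 0|; exists 0 => //=; rewrite normr0.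
have [_ [M AM]] := bopP A; exists `|M| => _ [x /= x1 <-].
rewrite (le_trans (AM x))// (@le_trans _ _ (`|M| * `|x|))//.
  by rewrite ler_wpM2r// ler_norm.
by rewrite ler_piMr.
Qed.

Lemma opnorm_ub A x : `|x| <= 1 -> `|A x| <= opnorm A.
Proof. by move=> x1; apply: (sup_upper_bound (opnorm_has_sup A)); exists x. Qed.

Lemma opnorm_le A M : (forall x, `|x| <= 1 -> `|A x| <= M) -> opnorm A <= M.
Proof.
move=> AM; apply: ge_sup => [|_ [x x1 <-]]; last exact: AM.
by case: (opnorm_has_sup A).
Qed.

Lemma opnorm_ge0 A : 0 <= opnorm A.
Proof. by apply: le_trans (opnorm_ub A (x := 0) _); rewrite ?normr0. Qed.

Lemma opnormD A B : opnorm (A + B) <= opnorm A + opnorm B.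
Proof.
apply: opnorm_le => x x1; change (`|A x + B x| <= opnorm A + opnorm B).
by rewrite (le_trans (ler_normD _ _))// lerD// opnorm_ub.
Qed.

Lemma opnormZ_le c A : opnorm (c *: A) <= `|c| * opnorm A.
Proof.
apply: opnorm_le => x x1; change (`|c *: A x| <= `|c| * opnorm A).
by rewrite normrZ ler_wpM2l// opnorm_ub.
Qed.

Lemma opnormZ c A : opnorm (c *: A) = `|c| * opnorm A.
Proof.
apply/eqP; rewrite eq_le opnormZ_le/=; have [->|c0] := eqVneq c 0.
  by rewrite normr0 mul0r opnorm_ge0.
rewrite -ler_pdivlMl ?normr_gt0// -normfV.
by rewrite -{1}[A]scale1r -(mulVf c0) -scalerA opnormZ_le.
Qed.

Lemma opnorm0_eq0 A : opnorm A = 0 -> A = 0.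
Proof.
move=> A0; apply: bop_eqP => x; apply/eqP; rewrite -normr_le0.
have [->|x0] := eqVneq x 0; first by rewrite bop0 normr0.
have nx0 : 0 < `|x| by rewrite normr_gt0.
have : `|A (`|x|^-1 *: x)| <= 0.
  by rewrite -A0 opnorm_ub// normrZ normfV normr_id mulVf// gt_eqF.
by rewrite bopZ normrZ pmulr_rle0// normr_gt0 invr_eq0 gt_eqF.
Qed.

HB.instance Definition _ :=
  Lmodule_isNormed.Build R (bop H) opnormD opnormZ opnorm0_eq0.

End bop_theory.

Section theta.
Context {R : realType} {H : hilbertType R}.

Definition reflection (L : bop H) : Prop :=
  exists (I : choiceType) (e : I -> H) (P : bop H),
    [/\ orthonormal_family e, forall x, fourier_sum e x (P x)
      & L = 2 *: P - 1].

(** The empty product is allowed; as [- 1] is a reflection (take [I] empty)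
    and [1 = (- 1) * (- 1)], requiring at least one factor would give the same
    set. *)
Definition Theta : set (bop H) :=
  [set A | exists s : seq (bop H),
    (forall L, L \in s -> reflection L) /\ A = \prod_(L <- s) L].

End theta.
Arguments Theta {R} H.

Definition is_orthogonal (R : realType) (H : hilbertType R) (f : H -> H) :
    Prop :=
  [/\ linear f, bijective f & forall x y, inner (f x) (f y) = inner x y].

Record orth (R : realType) (H : hilbertType R) := Orth {
  orth_fun :> H -> H;
  orthP : is_orthogonal orth_fun }.

HB.instance Definition _ (R : realType) (H : hilbertType R) :=
  gen_eqMixin (orth H).
HB.instance Definition _ (R : realType) (H : hilbertType R) :=
  gen_choiceMixin (orth H).

Section orth_theory.
Context {R : realType} {H : hilbertType R}.
Implicit Types s t u : orth H.

Lemma orth_eqP s t : s =1 t -> s = t.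
Proof.
case: s t => [f fO] [g gO] /funext/= fg.
by rewrite {}fg in fO *; congr Orth; exact: Prop_irrelevance.
Qed.

Lemma orth_norm s x : `|s x| = `|x|.
Proof.
have [_ _ sP] := orthP s.
by apply/eqP; rewrite -(@eqrXn2 _ 2)// -!inner_norm sP.
Qed.

Lemma orth_bounded_linear s : bounded_linear s.
Proof.
have [sL _ _] := orthP s.
by split=> //; exists 1 => x; rewrite orth_norm mul1r.
Qed.

Definition bop_of_orth s : bop H := Bop (asboolT (orth_bounded_linear s)).

Lemma is_orthogonal_id : is_orthogonal (@id H).
Proof. by split=> //; exists id. Qed.

Lemma is_orthogonal_comp s t : is_orthogonal (s \o t).
Proof.
have [[sL sB sP] [tL tB tP]] := (orthP s, orthP t); split.
- by move=> c x y; rewrite /= tL sL.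
- exact: bij_comp.
- by move=> x y; rewrite /= sP tP.
Qed.

Lemma orth_inv_ex s : exists t, cancel s t /\ cancel t s.
Proof.
have [sL [g sg gs] sP] := orthP s.
suff gO : is_orthogonal g by exists (Orth gO).
split; last by move=> x y; rewrite -sP !gs.
- by move=> c x y; apply: (can_inj sg); rewrite sL !gs.
- by exists s.
Qed.

Definition orth_one : orth H := Orth is_orthogonal_id.
Definition orth_mul s t : orth H := Orth (is_orthogonal_comp s t).
Definition orth_inv s : orth H := projT1 (cid (orth_inv_ex s)).

Lemma orth_mulA : associative orth_mul.
Proof. by move=> s t u; apply: orth_eqP. Qed.
Lemma orth_mul1l : left_id orth_one orth_mul.
Proof. by move=> s; apply: orth_eqP. Qed.
Lemma orth_mul1r : right_id orth_one orth_mul.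
Proof. by move=> s; apply: orth_eqP. Qed.
Lemma orth_mulVl : left_inverse orth_one orth_inv orth_mul.
Proof.
move=> s; apply: orth_eqP => x.
by rewrite /= /orth_inv; case: cid => t [/= st _]; exact: st.
Qed.
Lemma orth_mulVr : right_inverse orth_one orth_inv orth_mul.
Proof.
move=> s; apply: orth_eqP => x.
by rewrite /= /orth_inv; case: cid => t [/= _ ts]; exact: ts.
Qed.

HB.instance Definition _ := isGroup.Build (orth H)
  orth_mulA orth_mul1l orth_mul1r orth_mulVl orth_mulVr.

HB.instance Definition _ :=
  Topological.copy (orth H) (initial_topology bop_of_orth).

End orth_theory.

(* Main.v *)
Require Import Defs.
From mathcomp Require Import all_boot all_order all_algebra.
From mathcomp Require Import all_classical all_reals all_analysis.
From mathcomp Require Import sesquilinear finmap showcase.summability.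
From mathcomp Require Import ring.

Set Implicit Arguments.
Unset Strict Implicit.
Unset Printing Implicit Defensive.

Import Order.TTheory GRing.Theory Num.Theory.
Import numFieldNormedType.Exports.

Local Open Scope classical_set_scope.
Local Open Scope ring_scope.

(** Write [e] for an orthonormal family and [P x] for its Fourier sum at [x].
    By continuity of the inner product, [<P x, z>] is the unordered sum of the
    [<x, e i> <e i, z>] (inner_fourier_sum). This expression is symmetric in
    [x] and [z], so [P] is self-adjoint; it depends on [z] only through the
    coefficients [<z, e i>], which [P] preserves, so [<P x, P y> = <P x, y>].
    These two identities make [P] an orthogonal projection, and they are all
    that is needed of a reflection [L = 2 P - 1]: they give [L * L = 1] and
    [<L x, L y> = <x, y>]. A reflection is therefore an orthogonal map, and so
    is every finite product of reflections (Theta_orth).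

    As reflections are involutions, reversing a product of reflections inverts
    it (Theta_rinv); with concatenation for products, this makes [Theta H] a
    subgroup.

    The topology on [orth H] is the one induced by the operator norm. An
    orthogonal map preserves the vector norm, so composing with it on either
    side does not increase the operator norm. Continuity of the group
    operations follows from
      [s t - s' t' = s (t - t') + (s - s') t']  and
      [s^-1 - t^-1 = s^-1 (t - s) t^-1],
    and passes to the subgroup by restriction. *)

#[local] Existing Instance totally_filter.

(** * The inner product and Fourier sums *)

Section inner_product.
Context {R : realType} {H : hilbertType R}.
Implicit Types x y : H.

Lemma innerC x y : inner x y = inner y x.
Proof. by rewrite hermC expr0 mul1r. Qed.

Lemma innerZl c x y : inner (c *: x) y = c * inner x y.
Proof. by rewrite linearZl_LR. Qed.

Lemma innerZr c x y : inner x (c *: y) = c * inner x y.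
Proof. by rewrite innerC innerZl innerC. Qed.

Lemma innerDl x y z : inner (x + y) z = inner x z + inner y z.
Proof. by rewrite linearDl. Qed.

Lemma innerBl x y z : inner (x - y) z = inner x z - inner y z.
Proof. by rewrite linearBl. Qed.

Lemma innerBr x y z : inner z (x - y) = inner z x - inner z y.
Proof. by rewrite linearBr. Qed.

(** Expressing the inner product through the norm gives its continuity at once,
    from that of the norm. *)
Lemma inner_polarization x y :
  inner x y = 4^-1 * (`|x + y| ^+ 2 - `|x - y| ^+ 2).
Proof.
rewrite -!inner_norm innerDl innerBl !innerBr !(linearDr inner) /= (innerC y x).
by field.
Qed.

Lemma continuous_innerl y : continuous (fun x : H => inner x y).
Proof.
have -> : (fun x : H => inner x y) =
    (fun x => 4^-1 * (`|x + y| ^+ 2 - `|x - y| ^+ 2)).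
  by apply/funext => x; exact: inner_polarization.
move=> x; apply: cvgMr; apply: cvgB.
- apply: (@cvg_comp _ _ _ (fun x : H => `|x + y|) (fun r : R => r ^+ 2)).
    by apply: cvg_norm; apply: cvgD; [exact: cvg_id|exact: cvg_cst].
  exact: exprn_continuous.
- apply: (@cvg_comp _ _ _ (fun x : H => `|x - y|) (fun r : R => r ^+ 2)).
    by apply: cvg_norm; apply: cvgB; [exact: cvg_id|exact: cvg_cst].
  exact: exprn_continuous.
Qed.

Lemma inner_eq0 x : (forall z, inner x z = 0) -> x = 0.
Proof.
by move=> /(_ x)/eqP; rewrite inner_norm sqrf_eq0 normr_eq0 => /eqP.
Qed.

Lemma inner_fourier_sum (I : choiceType) (e : I -> H) (x px z : H) :
  fourier_sum e x px ->
  partial_sum (fun i => inner x (e i) * inner (e i) z) @ totally --> inner px z.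
Proof.
move=> fs.
have -> : partial_sum (fun i => inner x (e i) * inner (e i) z) =
    (inner ^~ z) \o partial_sum (fun i => inner x (e i) *: e i).
  apply/funext => A; rewrite /partial_sum /= (linear_sumlz inner) /=.
  by apply: eq_bigr => i _; rewrite innerZl.
exact: cvg_comp fs (@continuous_innerl z px).
Qed.

Lemma inner_fourier_sum_unique (I : choiceType) (e : I -> H) (x px z : H) r :
  fourier_sum e x px ->
  partial_sum (fun i => inner x (e i) * inner (e i) z) @ totally --> r ->
  inner px z = r.
Proof.
move=> /(@inner_fourier_sum _ _ _ _ z) fs fr.
exact: (@cvg_unique _ (@norm_hausdorff R R) _ _ _ _ fs fr).
Qed.

End inner_product.

(** * The projection onto the closed span of an orthonormal family *)

Section fourier_projection.
Context {R : realType} {H : hilbertType R} {I : choiceType}.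
Variables (e : I -> H) (P : bop H).
Hypotheses (eO : orthonormal_family e) (eP : forall x, fourier_sum e x (P x)).

(** Once a finite set of indices contains [j], orthonormality makes the pairing
    of the corresponding partial sum with [e j] equal to [<x, e j>], so the net
    of these pairings is eventually constant. *)
Lemma fourier_coef x j : inner (P x) (e j) = inner x (e j).
Proof.
have [e1 e0] := eO; apply: inner_fourier_sum_unique (@eP x) _.
apply: cvg_near_cst; exists [fset j]%fset => // A /=.
rewrite fsub1set => jA; rewrite /partial_sum (bigD1 [` jA]%fset) //= e1 mulr1.
rewrite big1 ?addr0 // => i ij; rewrite e0 ?mulr0 // => ij'.
by move/eqP: ij; apply; exact: val_inj.
Qed.

(** Both sides are the sum of the [<x, e i> <e i, y>]. *)
Lemma fourier_proj_sym x y : inner (P x) y = inner x (P y).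
Proof.
rewrite [RHS]innerC; apply: inner_fourier_sum_unique (@eP x) _.
rewrite (_ : (fun i => _) = fun i => inner y (e i) * inner (e i) x).
  exact: inner_fourier_sum (@eP y).
by apply/funext => i; rewrite mulrC innerC (innerC x).
Qed.

(** Both sides are sums of products of the coefficients of [x] with those of
    [P y] and [y] respectively, which agree by fourier_coef. *)
Lemma fourier_proj_inner x y : inner (P x) (P y) = inner (P x) y.
Proof.
apply: inner_fourier_sum_unique (@eP x) _.
rewrite (_ : (fun i => _) = fun i => inner x (e i) * inner (e i) y).
  exact: inner_fourier_sum (@eP x).
by apply/funext => i; rewrite !(innerC (e i)) fourier_coef.
Qed.

Lemma fourier_proj_idem : P * P = P.
Proof.
apply: bop_eqP => x; apply/eqP; rewrite -subr_eq0; apply/eqP.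
apply: inner_eq0 => z; rewrite innerBl.
change (inner (P (P x)) z - inner (P x) z = 0).
by rewrite fourier_proj_sym fourier_proj_inner subrr.
Qed.

End fourier_projection.

(** * Products of reflections *)

Section reflections.
Context {R : realType} {H : hilbertType R}.
Implicit Types (L A : bop H) (x y : H).

Lemma reflection_involutive L : reflection L -> L * L = 1.
Proof.
move=> [I [e [P [eO eP ->]]]].
have PP := fourier_proj_idem eO eP.
apply: bop_eqP => x; change (2 *: P (2 *: P x - x) - (2 *: P x - x) = x).
have PPx : P (P x) = P x by rewrite -[RHS]/((P : bop H) x) -{3}PP.
have -> : P (2 *: P x - x) = P x.
  by rewrite bopD bopZ PPx -[- x]scaleN1r bopZ scaleN1r scaler_nat mulr2n addrK.
by rewrite opprB addrC subrK.
Qed.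

(** Expanding [<2 P x - x, 2 P y - y>], the term [4 <P x, P y>] cancels
    [- 2 <P x, y> - 2 <x, P y>], since the three pairings are equal. *)
Lemma reflection_inner L x y : reflection L -> inner (L x) (L y) = inner x y.
Proof.
move=> [I [e [P [eO eP ->]]]].
change (inner (2 *: P x - x) (2 *: P y - y) = inner x y).
rewrite !innerBr !innerBl !innerZl !innerZr (fourier_proj_inner eO eP).
by rewrite -(fourier_proj_sym eP); ring.
Qed.

Lemma bop_of_orth1 : bop_of_orth (1%g : orth H) = 1.
Proof. exact: bop_eqP. Qed.

Lemma bop_of_orthM (s t : orth H) :
  bop_of_orth (s * t)%g = bop_of_orth s * bop_of_orth t.
Proof. exact: bop_eqP. Qed.

Lemma reflection_orth L : reflection L -> range (@bop_of_orth R H) L.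
Proof.
move=> rL.
have LL x : L (L x) = x.
  by rewrite -[LHS]/((L * L) x) reflection_involutive.
have oL : Defs.is_orthogonal L.
  split; first exact: bop_linear.
    by exists L.
  by move=> x y; exact: reflection_inner.
by exists (Orth oL) => //; exact: bop_eqP.
Qed.

Lemma Theta_orth : Theta H `<=` range (@bop_of_orth R H).
Proof.
move=> _ [s [+ ->]]; elim: s => [_|L s IH rs].
  by rewrite big_nil; exists 1%g => //; exact: bop_of_orth1.
rewrite big_cons.
have [t _ <-] : range (@bop_of_orth R H) L.
  by apply: reflection_orth; apply: rs; rewrite mem_head.
have [u _ <-] := IH (fun M Ms => rs M (mem_behead (s := L :: s) Ms)).
by exists (t * u)%g => //; exact: bop_of_orthM.
Qed.

Lemma Theta1 : Theta H 1.
Proof. by exists [::]; rewrite big_nil. Qed.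

Lemma ThetaM A B : Theta H A -> Theta H B -> Theta H (A * B).
Proof.
move=> [s [rs ->]] [t [rt ->]]; exists (s ++ t); rewrite big_cat; split=> // L.
by rewrite mem_cat => /orP[/rs|/rt].
Qed.

(** The inverse is the product in reverse order. A right inverse is enough: the
    elements of [Theta H] come from the group [orth H]. *)
Lemma Theta_rinv A : Theta H A -> exists2 B, Theta H B & A * B = 1.
Proof.
move=> [s [rs ->]]; exists (\prod_(L <- rev s) L).
  by exists (rev s); split=> // L; rewrite mem_rev => /rs.
elim: s rs => [_|L s IH rs]; first by rewrite !big_nil mulr1.
rewrite rev_cons -cats1 big_cat big_seq1 /= big_cons mulrA -(mulrA L).
rewrite IH ?mulr1; last by move=> M Ms; apply: rs; rewrite in_cons Ms orbT.
by apply: reflection_involutive; apply: rs; rewrite mem_head.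
Qed.

Lemma Theta_inv (s : orth H) :
  Theta H (bop_of_orth s) -> Theta H (bop_of_orth s^-1%g).
Proof.
move=> /Theta_rinv[B TB sB]; suff -> : bop_of_orth s^-1%g = B by [].
by rewrite -[LHS]mulr1 -sB mulrA -bop_of_orthM mulVg bop_of_orth1 mul1r.
Qed.

Lemma Theta_group_closed : group_closed (mem (@bop_of_orth R H @^-1` Theta H)).
Proof.
split=> [|s t /set_mem Ts /set_mem Tt]; apply: mem_set.
  by change (Theta H (bop_of_orth 1%g)); rewrite bop_of_orth1; exact: Theta1.
change (Theta H (bop_of_orth (s * t^-1)%g)).
by rewrite bop_of_orthM; apply: ThetaM => //; exact: Theta_inv.
Qed.

End reflections.

(** * Continuity of the group operations *)

Section topology.
Context {R : realType} {H : hilbertType R}.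
Implicit Types (A : bop H) (s t : orth H).

Lemma norm_orth_mull s A : `|bop_of_orth s * A| <= `|A|.
Proof.
apply: opnorm_le => x x1; change (`|s (A x)| <= opnorm A).
by rewrite orth_norm opnorm_ub.
Qed.

Lemma norm_orth_mulr s A : `|A * bop_of_orth s| <= `|A|.
Proof.
apply: opnorm_le => x x1; change (`|A (s x)| <= opnorm A).
by rewrite opnorm_ub// orth_norm.
Qed.

Lemma bop_of_orth_continuous : continuous (@bop_of_orth R H).
Proof. exact: (@initial_continuous (orth H) (bop H)). Qed.

Lemma orth_mul_continuous : continuous (fun p : orth H * orth H => p.1 * p.2)%g.
Proof.
apply: (@continuous_comp_initial (orth H) (orth H * orth H)%type (bop H)
  (@bop_of_orth R H)).
move=> p; apply/cvgrPdist_lt => eps eps0.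
have e2 : 0 < eps / 2 by rewrite divr_gt0.
near=> q; rewrite /= !bop_of_orthM.
have -> a b c d : a * b - c * d = a * (b - d) + (a - c) * d :> bop H.
  by rewrite mulrBr mulrBl addrA subrK.
rewrite (le_lt_trans (ler_normD _ _)) // [ltRHS](splitr eps) ltrD //.
- apply: le_lt_trans (norm_orth_mull _ _) _; near: q.
  apply: (@cvgr_dist_lt _ _ _ _ _ (fun q : orth H * orth H => bop_of_orth q.2)) => //.
  by apply: continuous_cvg; [exact: bop_of_orth_continuous|exact: cvg_snd].
- apply: le_lt_trans (norm_orth_mulr _ _) _; near: q.
  apply: (@cvgr_dist_lt _ _ _ _ _ (fun q : orth H * orth H => bop_of_orth q.1)) => //.
  by apply: continuous_cvg; [exact: bop_of_orth_continuous|exact: cvg_fst].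
Unshelve. all: by end_near. Qed.

Lemma orth_inv_continuous : continuous (fun s : orth H => s^-1)%g.
Proof.
apply: (@continuous_comp_initial (orth H) (orth H) (bop H) (@bop_of_orth R H)).
move=> s; apply/(@cvgrPdist_lt _ _ _ (nbhs s)) => eps eps0.
near=> t; rewrite /=.
rewrite (_ : _ - _ = bop_of_orth s^-1%g *
    ((bop_of_orth t - bop_of_orth s) * bop_of_orth t^-1%g)); last first.
  rewrite mulrBl mulrBr -!bop_of_orthM mulgV mulgA mulVg mul1g.
  by rewrite bop_of_orthM bop_of_orth1 mulr1.
apply: le_lt_trans (norm_orth_mull _ _) _.
apply: le_lt_trans (norm_orth_mulr _ _) _; rewrite distrC.
near: t; have /(@cvgrPdist_lt _ _ _ (nbhs s)) := @bop_of_orth_continuous s.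
by apply.
Unshelve. all: by end_near. Qed.

End topology.

Theorem corollary5p2 (R : realType) (K : choiceType) (H : hilbertType R)
    (dimH : hilbert_dimension H K) :
  [/\ topological_group (orth H),
      Theta H `<=` range (@bop_of_orth R H)
    & topological_subgroup (@bop_of_orth R H @^-1` Theta H)].
Proof.
split.
- by split; [exact: orth_mul_continuous|exact: orth_inv_continuous].
- exact: Theta_orth.
- split; first exact: Theta_group_closed.
    exact/continuous_subspaceT/orth_mul_continuous.
  exact/continuous_subspaceT/orth_inv_continuous.
Qed.
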